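(* Let $A$ and $B$ be irreducible square matrices of size greater than $1$ with entries in $\{0,1\}$ satisfying condition (I). Suppose that $(X_A,\sigma_A)$ and $(X_B,\sigma_B)$ are continuously orbit equivalent via a homeomorphism $h:X_A\to X_B$, with continuous functions $k_1,l_1:X_A\to\mathbb{Z}_+$ and $k_2,l_2:X_B\to\mathbb{Z}_+$ satisfying $$\sigma_B^{k_1(x)}(h(\sigma_A(x)))=\sigma_B^{l_1(x)}(h(x))\ (x\in X_A),\qquad \sigma_A^{k_2(y)}(h^{-1}(\sigma_B(y)))=\sigma_A^{l_2(y)}(h^{-1}(y))\ (y\in X_B).$$ If $x\in X_A$ is an eventually periodic point of $(X_A,\sigma_A)$, then $h(x)$ is an eventually periodic point of $(X_B,\sigma_B)$. Therefore the set of eventually periodic points is invariant under continuous orbit equivalence, i.e. $h$ maps the set of eventually periodic points of $X_A$ onto the set of eventually periodic points of $X_B$.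
   Context: For an $N\times N$ matrix $A$ ($N>1$) with entries in $\{0,1\}$, $X_A=\{(x_n)_{n\ge1}\in\{1,\dots,N\}^{\mathbb{N}}: A(x_n,x_{n+1})=1\ \forall n\ge1\}$ with the product topology, and $\sigma_A:X_A\to X_A$ is the shift $(x_n)_n\mapsto(x_{n+1})_n$. Condition (I) is that of Cuntz and Krieger; for an irreducible matrix it says that $A$ is not a permutation matrix, equivalently $X_A$ has no isolated points. $\mathbb{Z}_+=\{0,1,2,\dots\}$. A point $x\in X_A$ is eventually periodic if there exist $p,q\in\mathbb{Z}_+$ with $p\ne q$ and $\sigma_A^p(x)=\sigma_A^q(x)$. *)

(* Defs.v *)
From HB Require Import structures.
From mathcomp Require Import all_boot all_order all_algebra.
From mathcomp Require Import all_classical.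
From mathcomp Require Import topology.

Set Implicit Arguments.
Unset Strict Implicit.
Unset Printing Implicit Defensive.

Import GRing.Theory.

Local Open Scope classical_set_scope.

Definition zero_one N (A : 'M[nat]_N) : Prop :=
  forall i j, A i j = 0 \/ A i j = 1.

(* [A ^+ n] is the power of [A] for the matrix product, so its [(i, j)] entry
   counts the admissible paths of length [n] from [i] to [j]. *)
Definition irreducible N (A : 'M[nat]_N) : Prop :=
  forall i j, exists n, 0 < n /\ 0 < (A ^+ n)%R i j.

Definition edge N (A : 'M[nat]_N) : rel 'I_N := fun i j => A i j == 1.

(* The admissible path (i, s_1, ..., s_r, i) returns to [i] only at its end. *)
Definition first_return N (A : 'M[nat]_N) (i : 'I_N) (s : seq 'I_N) : Prop :=
  path (edge A) i (rcons s i) /\ i \notin s.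

Definition two_loops N (A : 'M[nat]_N) (i : 'I_N) : Prop :=
  exists s t, [/\ s <> t, first_return A i s & first_return A i t].

(* Condition (I) of Cuntz and Krieger, for a general matrix: every symbol leads
   to one that carries two different first-return paths.  For irreducible [A]
   this says that [A] is not a permutation matrix. *)
Definition condition_I N (A : 'M[nat]_N) : Prop :=
  forall i, exists j, connect (edge A) i j /\ two_loops A j.

Definition full_shift N : topologicalType :=
  prod_topology (fun _ : nat => discrete_topology 'I_N).

(* The alphabet {1, ..., N} and the index set {n | n >= 1} are both shifted
   to start at 0. *)
Definition admissible N (A : 'M[nat]_N) : set (full_shift N) :=
  [set x | forall n, A (x n) (x n.+1) = 1].

(* [set_type] carries the topology induced by the inclusion in [full_shift]. *)
Definition markov_shift N (A : 'M[nat]_N) : topologicalType :=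
  set_type (admissible A).

Section Shift.
Variables (N : nat) (A : 'M[nat]_N).

Lemma shift_admissible (x : markov_shift A) :
  (fun n => set_val x n.+1) \in admissible A.
Proof. by apply/mem_set => n; have /set_mem := valP x; apply. Qed.

Definition shift_map (x : markov_shift A) : markov_shift A :=
  exist (fun y => y \in admissible A) _ (shift_admissible x).

Definition eventually_periodic (x : markov_shift A) : Prop :=
  exists p q : nat, p <> q /\ iter p shift_map x = iter q shift_map x.

End Shift.

Arguments shift_map {N} A x.
Arguments eventually_periodic {N} A x.

(* Main.v *)
(* Eventual periodicity is constant along orbits, and [h (shift x)] and [h x]
   have a common forward image, so only a periodic point x needs care.  If
   sigma^p x = x, summing the cocycle over one period gives a, b, constant near
   x, with sigma^a (h (sigma^p z)) = sigma^b (h z).  If a <> b, then h x is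
   eventually periodic.  If a = b, then for z near x the points h (sigma^p z)
   and h z also agree with h x on their first a coordinates, so they are equal,
   and sigma^p z = z by injectivity; hence z = x and x is isolated, which
   condition (I) forbids. *)
Require Import Defs.
From mathcomp Require Import all_boot all_order all_algebra.
From mathcomp Require Import all_classical.
From mathcomp Require Import topology.

Set Implicit Arguments.
Unset Strict Implicit.
Unset Printing Implicit Defensive.

Local Open Scope classical_set_scope.

(** * Topology of the shift space and coordinates of iterated shifts *)

Section MarkovShift.
Context {N : nat} {A : 'M[nat]_N}.
Implicit Types (x y z : markov_shift A) (F : set_system (markov_shift A)).

Lemma markov_shift_ext x y : set_val x =1 set_val y -> x = y.
Proof. by move=> xy; apply: val_inj; apply: funext. Qed.

(** The topology is induced by a product of discrete factors, so convergence is tested coordinate by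
    coordinate, and in each factor it means eventual equality. *)
Lemma markov_shift_cvgP F x : Filter F ->
  F --> x <-> forall n, F [set z | set_val z n = set_val x n].
Proof.
move=> FF; split=> [Fx n|Fx].
  apply: Fx; apply: (@initial_continuous _ (full_shift N) set_val x
    [set w | w n = set_val x n]).
  apply: (@proj_continuous nat (fun=> discrete_topology 'I_N) n (set_val x)
    [set set_val x n]).
  exact: discrete_set1.
move=> U [_ [[W Wopen <-] Wx] WU]; apply: filterS WU _.
suff : set_val @ F --> (set_val x : full_shift N).
  by apply; exact: open_nbhs_nbhs.
apply/cvg_sup => i V [_ [[O _ <-] Ox] OV].
apply: filterS OV _.
suff: F [set z | O (set_val z i)] by [].
by apply: filterS (Fx i) => z /= ->.
Qed.

Lemma near_coord x n : \forall z \near x, set_val z n = set_val x n.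
Proof. exact: ((markov_shift_cvgP x (nbhs_filter x)).1 cvg_id). Qed.

Lemma near_coord_eq x n :
  \forall z \near x, forall i, i < n -> set_val z i = set_val x i.
Proof.
elim: n => [|n IHn]; first exact: filterE.
apply: filterS2 IHn (near_coord x n) => z IHz zn i; rewrite ltnS leq_eqVlt.
by case/predU1P => [->|/IHz].
Qed.

Lemma shift_continuous : continuous (shift_map A).
Proof.
move=> x; apply: (markov_shift_cvgP _ (fmap_filter _ (nbhs_filter x))).2 => n.
exact: near_coord x n.+1.
Qed.

Lemma iter_shift_continuous n : continuous (iter n (shift_map A)).
Proof.
elim: n => [|n IHn] x; first exact: cvg_id.
exact: (@continuous_comp _ _ _ (iter n (shift_map A)) (shift_map A)
  x (IHn x) (@shift_continuous _)).
Qed.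

Lemma iter_shiftE n x i :
  set_val (iter n (shift_map A) x) i = set_val x (i + n).
Proof. by elim: n i => [|n IHn] i; rewrite ?addn0 //= addnS -addSn -IHn. Qed.

Lemma iter_shift_inj n x y : (forall i, i < n -> set_val x i = set_val y i) ->
  iter n (shift_map A) x = iter n (shift_map A) y -> x = y.
Proof.
move=> xy sxy; apply: markov_shift_ext => i.
by case: (ltnP i n) => [/xy //|/subnK <-]; rewrite -!iter_shiftE sxy.
Qed.

Lemma eventually_periodic_iter n x :
  eventually_periodic A (iter n (shift_map A) x) <-> eventually_periodic A x.
Proof.
split=> -[p [q [pq]]].
  rewrite -!iterD => sx; exists (p + n), (q + n); split=> //.
  by move/addIn.
move=> sx; exists p, q; split=> //.
by rewrite -!iterD addnC iterD sx -iterD addnC.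
Qed.

(** A point fixed by the [p]-th shift is determined by one period: coordinate [i] equals coordinate
    [i - p] as soon as [p <= i]. *)
Lemma periodic_coord_inj p x y : 0 < p ->
    iter p (shift_map A) x = x -> iter p (shift_map A) y = y ->
  (forall i, i < p -> set_val x i = set_val y i) -> x = y.
Proof.
move=> p0 sx sy xy; apply: markov_shift_ext => i.
elim/ltn_ind: i => i IHi; case: (ltnP i p) => [/xy //|pi].
have lt : i - p < i by rewrite ltn_subrL p0 (leq_trans p0 pi).
by rewrite -(subnK pi) -!iter_shiftE sx sy IHi.
Qed.

End MarkovShift.

Arguments iter_shift_continuous {N A} n x t _.

(** * Condition (I) excludes isolated points *)

Section NoIsolatedPoint.
Context {N : nat} {A : 'M[nat]_N}.
Implicit Types (i j : 'I_N) (s t : seq 'I_N) (y z : nat -> 'I_N).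

(** This is the form in which condition (I) is used: a finite prefix leading to [i] can be continued
    in two ways. *)
Definition branching i := exists y z,
  [/\ admissible A y, admissible A z, y 0 = i, z 0 = i & y <> z].

Definition scons i y : nat -> 'I_N := fun n => if n is m.+1 then y m else i.

Lemma scons_admissible i y :
  edge A i (y 0) -> admissible A y -> admissible A (scons i y).
Proof. by move=> /eqP iy yA [|n] /=. Qed.

Lemma branching_edge i j : edge A i j -> branching j -> branching i.
Proof.
move=> ij [y [z [yA zA yj zj yz]]]; exists (scons i y), (scons i z).
split=> //; do ?by apply: scons_admissible => //; rewrite ?yj ?zj.
by move=> /funeqP e; apply: yz; apply/funeqP => n; exact: (e n.+1).
Qed.

Lemma branching_connect i j : connect (edge A) i j -> branching j -> branching i.
Proof.
move=> /connectP[u]; elim: u i => [|k u IHu] i /=; first by move=> _ ->.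
by move=> /andP[ik ku] ej jb; exact: branching_edge ik (IHu _ ku ej jb).
Qed.

(** The cycle [j :: s] repeated forever; the index stays within the list, so the default of [nth] is
    never reached. *)
Definition loop_word j s : nat -> 'I_N := fun n => nth j (j :: s) (n %% (size s).+1).

Lemma loop_word_admissible j s :
  path (edge A) j (rcons s j) -> admissible A (loop_word j s).
Proof.
move=> /(pathP j) js n; rewrite /loop_word modnS.
have ltr : n %% (size s).+1 < (size s).+1 by rewrite ltn_mod.
have := js (n %% (size s).+1); rewrite size_rcons => /(_ ltr) /eqP.
rewrite -rcons_cons !nth_rcons /= ltr.
(* The index wraps around to 0 exactly after the last position of the cycle, where the path takes
   its closing edge back to [j]. *)
have -> : ((size s).+1 %| n.+1) = (n %% (size s).+1 == size s).
  apply/idP/eqP => [dvd|e]; last by rewrite /dvdn -addn1 -modnDml e addn1 modnn.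
  apply/eqP; rewrite -eqSS eqn_leq ltr /=; apply: dvdn_leq => //.
  by rewrite /dvdn -addn1 modnDml addn1.
by case: ltngtP => // /leq_trans/(_ ltr); rewrite ltnn.
Qed.

(* The first return to j in [loop_word j s] happens at time [(size s).+1]. *)
Lemma loop_word_size j s t : j \notin t ->
  loop_word j s =1 loop_word j t -> size t <= size s.
Proof.
move=> jt st; rewrite leqNgt; apply: contra jt => lt_st.
have := st (size s).+1; rewrite /loop_word modnn modn_small //= => ->.
exact: mem_nth.
Qed.

Lemma loop_word_inj j s t : j \notin s -> j \notin t ->
  loop_word j s =1 loop_word j t -> s = t.
Proof.
move=> js jt st; have eqst : size s = size t.
  by apply/eqP; rewrite eqn_leq !(@loop_word_size j) // => n; rewrite st.
apply: (eq_from_nth (x0 := j)) => // i ltis.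
by have := st i.+1; rewrite /loop_word -eqst modn_small.
Qed.

Lemma two_loops_branching j : two_loops A j -> branching j.
Proof.
move=> [s [t [st [js njs] [jt njt]]]]; exists (loop_word j s), (loop_word j t).
split; rewrite ?/loop_word ?mod0n //; do ?exact: loop_word_admissible.
by move=> /funeqP /(loop_word_inj njs njt).
Qed.

Lemma condition_I_branching : condition_I A -> forall i, branching i.
Proof.
by move=> AI i; have [j [ij /two_loops_branching]] := AI i; exact: branching_connect.
Qed.

Definition splice y n z : nat -> 'I_N :=
  fun m => if m < n then y m else z (m - n).

Lemma splice_admissible y n z : admissible A y -> admissible A z -> z 0 = y n ->
  admissible A (splice y n z).
Proof.
move=> yA zA zy m; rewrite /splice; case: (ltngtP m.+1 n) => [lt|lt|eq].
- exact: yA.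
- by rewrite subSn //; exact: zA.
- by rewrite -eq subnn zy -eq; exact: yA.
Qed.

(** The first [n] letters of [x] are followed by either of two distinct admissible tails starting at
    the letter [x n]. The two splices differ, so they cannot both be [x]. *)
Lemma condition_I_not_isolated (x : markov_shift A) (n : nat) : condition_I A ->
  exists2 z : markov_shift A, z <> x & forall m, m < n -> set_val z m = set_val x m.
Proof.
move=> AI; have [y [z [yA zA yn zn yz]]] := condition_I_branching AI (set_val x n).
have xA : admissible A (set_val x) by apply/set_mem; exact: valP.
suff [w [wA wn wx]] : exists w : nat -> 'I_N,
    [/\ admissible A w, w 0 = set_val x n & splice (set_val x) n w <> set_val x].
  exists (exist (fun v => v \in admissible A) _
    (mem_set (splice_admissible xA wA wn)) : markov_shift A).
    by move=> /(congr1 set_val).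
  by move=> m lt; suff: splice (set_val x) n w m = set_val x m by []; rewrite /splice lt.
have [ey|] := pselect (splice (set_val x) n y = set_val x); last by exists y.
exists z; split=> // ez; apply: yz; apply: funext => m.
have := congr1 (@^~ (m + n)) (etrans ey (esym ez)).
by rewrite /splice ltnNge leq_addl /= addnK.
Qed.

Lemma condition_I_no_isolated_point (x : markov_shift A) :
  condition_I A -> ~ nbhs x [set x].
Proof.
move=> AI xiso.
pose u n := projT1 (cid2 (condition_I_not_isolated x n AI)).
have uP n : u n <> x /\ forall m, m < n -> set_val (u n) m = set_val x m.
  by rewrite /u; case: cid2.
have ux : u @ \oo --> x.
  apply: (markov_shift_cvgP _ _).2 => i; exists i.+1 => // n lt.
  by have [_] := uP n; exact.
have [n _ /(_ n (leqnn n))] := ux _ xiso.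
by have [] := uP n.
Qed.

End NoIsolatedPoint.

(** * Orbit maps and eventually periodic points *)

Section OrbitMap.
Context {N M : nat} {A : 'M[nat]_N} {B : 'M[nat]_M}.
Variables (h : markov_shift A -> markov_shift B) (k l : markov_shift A -> nat).
Hypothesis orbit : forall x,
  iter (k x) (shift_map B) (h (shift_map A x)) = iter (l x) (shift_map B) (h x).

Lemma orbit_map_eventually_periodic_iter n x :
  eventually_periodic B (h (iter n (shift_map A) x)) <->
  eventually_periodic B (h x).
Proof.
elim: n => //= n <-; set y := iter n _ x.
by rewrite -(eventually_periodic_iter (k y)) orbit eventually_periodic_iter.
Qed.

Hypotheses (kcont : continuous k) (lcont : continuous l).

Lemma orbit_map_cocycle n (x : markov_shift A) : exists a b, \forall z \near x,
  iter a (shift_map B) (h (iter n (shift_map A) z)) = iter b (shift_map B) (h z).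
Proof.
elim: n => [|n [a [b IHn]]]; first by exists 0, 0; exact: filterE.
(* A continuous function to the discrete space [nat] is locally constant; this lets the exponents be
   frozen at their values at [x]. *)
have near_const (f : markov_shift A -> nat) : continuous f ->
    \forall z \near x, f (iter n (shift_map A) z) = f (iter n (shift_map A) x).
  move=> fcont.
  have := fcont (iter n (shift_map A) x) _ (discrete_set1 _).
  exact: (iter_shift_continuous n x).
set y := iter n (shift_map A) x.
(* Apply the [a]-th shift to the orbit relation at the [n]-th shift of [z], commute it past the
   [l y]-th shift, then use the induction hypothesis. *)
exists (a + k y), (l y + b).
apply: filterS3 IHn (near_const _ kcont) (near_const _ lcont) => z IHz kz lz.
by rewrite iterD -kz /= orbit lz -iterD addnC iterD IHz -iterD.
Qed.

Lemma orbit_map_eventually_periodic x : condition_I A -> continuous h ->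
  injective h -> eventually_periodic A x -> eventually_periodic B (h x).
Proof.
move=> AI hcont hinj [p [q [/eqP neq_pq sx]]].
wlog lt_pq : p q neq_pq sx / p < q => [wlg|].
  have [lt|lt] : p < q \/ q < p by apply/orP; rewrite -neq_ltn.
    exact: (wlg p q).
  by apply: (wlg q p); rewrite // eq_sym.
(* Replace [x] by its [p]-th shift [w], which is genuinely periodic with period [r]. *)
rewrite -(orbit_map_eventually_periodic_iter p).
set w := iter p (shift_map A) x; pose r := q - p.
have r0 : 0 < r by rewrite subn_gt0.
have sw : iter r (shift_map A) w = w by rewrite /w -iterD subnK // ltnW.
have [a [b ab]] := orbit_map_cocycle r w.
have [eab|/eqP neq] := eqVneq a b; last first.
  by exists a, b; split=> //; have := nbhs_singleton ab; rewrite sw.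
subst b; exfalso; apply: (condition_I_no_isolated_point (x := w) AI).
have hw : \forall z \near w, forall i, i < a -> set_val (h z) i = set_val (h w) i.
  exact: (hcont w) (near_coord_eq (h w) a).
(* Since [w] is fixed by the [r]-th shift, that shift sends points near [w] to points near [w],
   where the previous estimate applies. *)
have hsw : \forall z \near w, forall i, i < a ->
    set_val (h (iter r (shift_map A) z)) i = set_val (h w) i.
  apply: (iter_shift_continuous r w
    [set z | forall i, i < a -> set_val (h z) i = set_val (h w) i]).
  by rewrite sw.
near=> z.
(* It remains to see that the [r]-th shift fixes [z], as [z] and [w] share their first [r]
   letters. *)
apply: (periodic_coord_inj r0) => //; last by near: z; exact: near_coord_eq.
apply: hinj; apply: (iter_shift_inj (n := a)); last by near: z.
have hz : forall i, i < a -> set_val (h z) i = set_val (h w) i by near: z.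
have hsz : forall i, i < a ->
  set_val (h (iter r (shift_map A) z)) i = set_val (h w) i by near: z.
by move=> i lt; rewrite hsz ?hz.
Unshelve. all: by end_near.
Qed.

End OrbitMap.

Theorem proposition3p5 (N M : nat) (A : 'M[nat]_N) (B : 'M[nat]_M)
  (hN : 1 < N) (hM : 1 < M)
  (A01 : zero_one A) (B01 : zero_one B)
  (Airr : irreducible A) (Birr : irreducible B)
  (AI : condition_I A) (BI : condition_I B)
  (h : markov_shift A -> markov_shift B) (hinv : markov_shift B -> markov_shift A)
  (hK : cancel h hinv) (hinvK : cancel hinv h)
  (hcont : continuous h) (hinvcont : continuous hinv)
  (k1 l1 : markov_shift A -> nat) (k2 l2 : markov_shift B -> nat)
  (k1cont : continuous k1) (l1cont : continuous l1)
  (k2cont : continuous k2) (l2cont : continuous l2)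
  (orbit1 : forall x : markov_shift A,
     iter (k1 x) (shift_map B) (h (shift_map A x)) = iter (l1 x) (shift_map B) (h x))
  (orbit2 : forall y : markov_shift B,
     iter (k2 y) (shift_map A) (hinv (shift_map B y)) =
     iter (l2 y) (shift_map A) (hinv y)) :
  (forall x : markov_shift A, eventually_periodic A x -> eventually_periodic B (h x)) /\
  h @` [set x : markov_shift A | eventually_periodic A x] =
    [set y : markov_shift B | eventually_periodic B y].
Proof.
have hP x : eventually_periodic A x -> eventually_periodic B (h x).
  exact: (orbit_map_eventually_periodic orbit1 k1cont l1cont AI hcont (can_inj hK)).
split=> //; apply/seteqP; split=> [_ [x /hP hx <-] //|y yP].
(* Surjectivity is the same result for [hinv], with the roles of [A] and [B] exchanged. *)
exists (hinv y); last exact: hinvK.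
exact: (orbit_map_eventually_periodic orbit2 k2cont l2cont BI hinvcont
  (can_inj hinvK) yP).
Qed.
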